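(* Assume that $\delta:H\to\mathbb R^p$ is concave and that each column map $\Psi_{:,k}(\cdot):H\to\mathbb R^p$, $k=1,\dots,m$, is concave, convex, or affine on $H$. Let $u^1,\dots,u^N\in\mathcal U\cap\mathcal S(\Psi)$ satisfy $\Psi(x^j)u^j+\delta(x^j)\ge 0$ for all $j=1,\dots,N$. If $$\big(\Psi(x^i)-\Psi(x^j)\big)\big(u^i-u^j\big)\le 0\qquad\text{for all } i,j\in\{1,\dots,N\},$$ then for every $\lambda\in\Delta_N$ and $x=\sum_{j=1}^N\lambda_jx^j$, the convex blend $u_\lambda=\sum_{j=1}^N\lambda_ju^j$ satisfies $\Psi(x)u_\lambda+\delta(x)\ge 0$.
   Context: Setting. Consider the control-affine system $\dot x=f(x)+g(x)u$ with $x\in\mathcal X\subseteq\mathbb R^n$, $u\in\mathcal U\subseteq\mathbb R^m$, where $f:\mathbb R^n\to\mathbb R^n$ and $g:\mathbb R^n\to\mathbb R^{n\times m}$ are locally Lipschitz and $\mathcal U$ is nonempty, compact and convex. Let $h_1,\dots,h_p:\mathcal X\to\mathbb R$ be $C^1$ and let $\alpha_1,\dots,\alpha_p$ be extended class-$\mathcal K_\infty$ functions (continuous, strictly increasing bijections $\mathbb R\to\mathbb R$ with $\alpha_i(0)=0$). With $\nabla h_i(x)$ the gradient as a row vector, put $L_fh_i(x)=\nabla h_i(x)f(x)\in\mathbb R$ and $L_gh_i(x)=\nabla h_i(x)g(x)\in\mathbb R^{1\times m}$. Let $\Psi(x)\in\mathbb R^{p\times m}$ be the matrix whose $i$th row is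 $L_gh_i(x)$, and let $\delta(x)\in\mathbb R^p$ have entries $\delta_i(x)=L_fh_i(x)+\alpha_i(h_i(x))$. The stacked control barrier function inequalities at $x$ are $\Psi(x)u+\delta(x)\ge 0$. Points $x^1,\dots,x^N\in\mathcal X$ (''vertices'') are given with convex hull $H=\mathrm{co}\{x^1,\dots,x^N\}\subseteq\mathcal X$. The simplex is $\Delta_N=\{\lambda\in\mathbb R^N:\lambda_j\ge 0,\ \sum_j\lambda_j=1\}$. Conventions. Vector inequalities are componentwise; concavity/convexity of vector-valued maps is componentwise. $\Psi_{:,k}$ is the $k$th column of $\Psi$. When every column map $\Psi_{:,k}(\cdot)$ is concave, convex or affine on $H$, define for each $k$: $\mathcal S_k(\Psi)=\mathbb R$ if $\Psi_{:,k}$ is affine on $H$ (this case takes precedence); otherwise $\mathcal S_k(\Psi)=[0,\infty)$ if $\Psi_{:,k}$ is concave on $H$ and $\mathcal S_k(\Psi)=(-\infty,0]$ if $\Psi_{:,k}$ is convex on $H$. The sign-aligned cone is $\mathcal S(\Psi)=\{u\in\mathbb R^m:\ u_k\in\mathcal S_k(\Psi)\text{ for all }k\}$. *)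

(* Defs.v *)
From mathcomp Require Import all_boot all_order all_algebra.
From mathcomp Require Import all_classical all_reals all_analysis.

Set Implicit Arguments.
Unset Strict Implicit.
Unset Printing Implicit Defensive.

Import Order.TTheory GRing.Theory Num.Theory.
Import numFieldNormedType.Exports.

Local Open Scope classical_set_scope.
Local Open Scope ring_scope.
Local Open Scope convex_scope.

Definition vle (R : realType) (q : nat) (u v : 'cV[R]_q) : Prop :=
  forall i, u i 0 <= v i 0.

Definition simplex (R : realType) (N : nat) : set 'cV[R]_N :=
  [set l | (forall j, 0 <= l j 0) /\ \sum_j l j 0 = 1].

Definition cvx_comb (R : realType) (n N : nat) (l : 'cV[R]_N)
    (x : 'I_N -> 'cV[R]_n) : 'cV[R]_n :=
  \sum_j l j 0 *: x j.

Definition cvx_hull (R : realType) (n N : nat) (x : 'I_N -> 'cV[R]_n) :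
    set 'cV[R]_n :=
  [set cvx_comb l x | l in @simplex R N].

(* The library has [convex_function] only; these are its two companions. *)
Definition concave_function (R : realType) (E : lmodType R)
    (E' := convex_lmodType E) (D : set E') (f : E' -> R^o) : Prop :=
  forall t : {i01 R},
    {in D &, forall x y : E', f x <| t |> f y <= f (x <| t |> y)}.

Definition affine_function (R : realType) (E : lmodType R)
    (E' := convex_lmodType E) (D : set E') (f : E' -> R^o) : Prop :=
  forall t : {i01 R},
    {in D &, forall x y : E', f (x <| t |> y) = f x <| t |> f y}.

Definition concave_map (R : realType) (n q : nat) (D : set 'cV[R]_n)
    (F : 'cV[R]_n -> 'cV[R]_q) : Prop :=
  forall i, @concave_function R 'cV[R]_n D (fun x => F x i 0).

Definition convex_map (R : realType) (n q : nat) (D : set 'cV[R]_n)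
    (F : 'cV[R]_n -> 'cV[R]_q) : Prop :=
  forall i, @convex_function R 'cV[R]_n D (fun x => F x i 0).

Definition affine_map (R : realType) (n q : nat) (D : set 'cV[R]_n)
    (F : 'cV[R]_n -> 'cV[R]_q) : Prop :=
  forall i, @affine_function R 'cV[R]_n D (fun x => F x i 0).

Definition locally_lipschitz (R : realType) (V W : normedModType R)
    (f : V -> W) : Prop :=
  forall x : V, exists2 B : set V, nbhs x B & [lipschitz f y | y in B].

Definition gradient (R : realType) (n : nat) (h : 'cV[R]_n -> R)
    (x : 'cV[R]_n) : 'rV[R]_n :=
  \row_j 'D_(delta_mx j 0) h x.

(* [X] need not be open: as usual, being C^1 on [X] means being C^1 on an open
   set containing [X], so that the gradient makes sense at every point of [X].
   The values of the total function [h] outside that open set are irrelevant. *)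
Definition C1_on (R : realType) (n : nat) (X : set 'cV[R]_n)
    (h : 'cV[R]_n -> R) : Prop :=
  exists O : set 'cV[R]_n,
    [/\ open O, X `<=` O, (forall x, O x -> differentiable h x)
      & {within O, continuous (gradient h)}].

Definition ext_class_Kinf (R : realType) (a : R -> R) : Prop :=
  [/\ continuous a, {homo a : s t / s < t}, bijective a & a 0 = 0].

Definition lie_f (R : realType) (n : nat) (f : 'cV[R]_n -> 'cV[R]_n)
    (h : 'cV[R]_n -> R) (x : 'cV[R]_n) : R :=
  (gradient h x *m f x) 0 0.

Definition lie_g (R : realType) (n m : nat) (g : 'cV[R]_n -> 'M[R]_(n, m))
    (h : 'cV[R]_n -> R) (x : 'cV[R]_n) : 'rV[R]_m :=
  gradient h x *m g x.

Definition Psi (R : realType) (n m p : nat) (g : 'cV[R]_n -> 'M[R]_(n, m))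
    (h : 'I_p -> 'cV[R]_n -> R) (x : 'cV[R]_n) : 'M[R]_(p, m) :=
  \matrix_(i < p) lie_g g (h i) x.

Definition delta (R : realType) (n p : nat) (f : 'cV[R]_n -> 'cV[R]_n)
    (h : 'I_p -> 'cV[R]_n -> R) (alpha : 'I_p -> R -> R) (x : 'cV[R]_n) :
    'cV[R]_p :=
  \col_(i < p) (lie_f f (h i) x + alpha i (h i x)).

(* Only meaningful when column [k] of [P] is concave, convex or affine on [H]:
   the last branch is then the convex, neither affine nor concave, case. *)
Definition sign_set (R : realType) (n m p : nat) (H : set 'cV[R]_n)
    (P : 'cV[R]_n -> 'M[R]_(p, m)) (k : 'I_m) : set R :=
  if `[< affine_map H (fun x => col k (P x)) >] then setT
  else if `[< concave_map H (fun x => col k (P x)) >] then [set r | 0 <= r]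
  else [set r | r <= 0].

Definition sign_cone (R : realType) (n m p : nat) (H : set 'cV[R]_n)
    (P : 'cV[R]_n -> 'M[R]_(p, m)) : set 'cV[R]_m :=
  [set u | forall k, sign_set H P k (u k 0)].

(* Main.v *)
(* Since u_lambda lies in the sign-aligned cone, Jensen's inequality column by
   column gives Psi(x) u_lambda >= sum_j lambda_j Psi(x^j) u_lambda.  The
   monotonicity hypothesis and Chebyshev's sum inequality bound the right-hand
   side below by sum_j lambda_j Psi(x^j) u^j, and concavity of delta reduces the
   claim to the averaged vertex inequalities. *)

Require Import Defs.
From mathcomp Require Import all_boot all_order all_algebra.
From mathcomp Require Import all_classical all_reals all_analysis.
Import Order.TTheory GRing.Theory Num.Theory.
Import numFieldNormedType.Exports.
Local Open Scope classical_set_scope.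
Local Open Scope ring_scope.

(** Induction on [N]: the sum is a two-point combination of the first point and the tail, once the
    tail is divided by its total weight [s]. *)
Lemma convex_set_sum (R : realFieldType) (E : lmodType R) (A : set E) (N : nat)
    (l : 'I_N -> R) (x : 'I_N -> E) :
  convex_set (M := E) A -> (forall j, 0 <= l j) -> \sum_j l j = 1 ->
  (forall j, x j \in A) -> \sum_j l j *: x j \in A.
Proof.
move=> convA; elim: N l x => [|N IHN] l x l_ge0.
  by rewrite big_ord0 => /eqP; rewrite eq_sym oner_eq0.
rewrite !big_ord_recl /=.
set s := \sum_(i < N) l (lift ord0 i) => ls1 xA.
have s_ge0 : 0 <= s by apply: sumr_ge0.
have l0E : 1 - l ord0 = s by rewrite -ls1 addrC addKr.
(* For [s = 0] the tail cannot be renormalised, but then all its weights vanish and the sum is the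
   first point itself. *)
have [s0|s_neq0] := eqVneq s 0.
  rewrite big1 ?addr0 => [|i _].
    by move/eqP: l0E; rewrite s0 subr_eq0 => /eqP <-; rewrite scale1r.
  by rewrite (psumr_eq0P _ s0) ?scale0r.
have l0_le1 : l ord0 <= 1 by rewrite -subr_ge0 l0E.
have tailA : \sum_(i < N) (l (lift ord0 i) / s) *: x (lift ord0 i) \in A.
  apply: IHN => [j||j]; first by rewrite divr_ge0.
    by rewrite -mulr_suml divff.
  exact: xA.
have := convA _ _ (Itv01 (l_ge0 ord0) l0_le1) (xA ord0) tailA.
congr (_ \in A); congr (_ + _).
rewrite -[X in X *: _]/(1 - l ord0) l0E scaler_sumr; apply: eq_bigr => i _.
by rewrite scalerA mulrCA divff ?mulr1.
Qed.

(* Jensen's inequality, as [convex_set_sum] applied to the hypograph. *)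
Lemma concave_function_sum (R : realType) (E : lmodType R) (D : set E)
    (f : E -> R^o) (N : nat) (l : 'I_N -> R) (x : 'I_N -> E) :
  convex_set (M := E) D -> concave_function D f ->
  (forall j, 0 <= l j) -> \sum_j l j = 1 -> (forall j, x j \in D) ->
  \sum_j l j * f (x j) <= f (\sum_j l j *: x j).
Proof.
move=> convD concf l_ge0 l_sum1 xD.
pose hyp : set (E * R^o)%type := [set z | z.1 \in D /\ z.2 <= f z.1].
have conv_hyp : convex_set (M := (E * R^o)%type) hyp.
  move=> [x1 r1] [x2 r2] t /set_mem[/= x1D r1f] /set_mem[/= x2D r2f].
  apply: mem_set; split; first exact: convD.
  apply: le_trans (concf t _ _ x1D x2D).
  by apply: lerD; apply: ler_wpM2l; rewrite // ?ge0 ?subr_ge0 ?le1.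
have xhyp j : (x j, f (x j)) \in hyp by apply: mem_set; split=> /=.
have /set_mem[_] := convex_set_sum _ _ _ _ _ _ conv_hyp l_ge0 l_sum1 xhyp.
(* The two projections are additive, so the components of the combination in the product space are
   the two sums in the claim. *)
by rewrite !raddf_sum.
Qed.

Lemma convex_function_opp (R : realType) (E : lmodType R) (D : set E)
    (f : E -> R^o) :
  convex_function (E := E) D f -> concave_function D (fun x => - f x).
Proof. by move=> convf t x y xD yD; rewrite -convN lerN2; exact: convf. Qed.

Lemma cvx_hull_convex (R : realType) (n N : nat) (x : 'I_N -> 'cV[R]_n) :
  convex_set (M := 'cV[R]_n) (cvx_hull x).
Proof.
move=> _ _ t /set_mem[l [l_ge0 l1] <-] /set_mem[k [k_ge0 k1] <-].
apply: mem_set; exists (t%:inum *: l + (1 - t%:inum) *: k).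
  split=> [j|].
    rewrite !mxE addr_ge0 ?mulr_ge0 ?ge0 //.
  under eq_bigr => j _ do rewrite !mxE.
  by rewrite big_split /= -!mulr_sumr l1 k1 !mulr1 subrKC.
rewrite /conv /= /cvx_comb !scaler_sumr -big_split /=.
by apply: eq_bigr => j _; rewrite !mxE scalerDl !scalerA.
Qed.

Lemma cvx_hull_vertex (R : realType) (n N : nat) (x : 'I_N -> 'cV[R]_n) j :
  cvx_hull x (x j).
Proof.
exists (delta_mx j 0).
  split=> [i|]; first by rewrite mxE; case: (_ && _).
  rewrite (bigD1 j) //= big1 ?addr0 => [|i /negbTE ij]; by rewrite mxE ?eqxx ?ij.
rewrite /cvx_comb (bigD1 j) //= big1 ?addr0 => [|i /negbTE ij].
  by rewrite mxE !eqxx scale1r.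
by rewrite mxE ij scale0r.
Qed.

(* Chebyshev's sum identity: the weighted double sum of the products of
   differences is twice the gap between the two sides. *)
Lemma vle_mul_cvx_comb (R : realType) (m p N : nat) (l : 'cV[R]_N)
    (P : 'I_N -> 'M[R]_(p, m)) (u : 'I_N -> 'cV[R]_m) :
  @simplex R N l ->
  (forall i j, vle ((P i - P j) *m (u i - u j)) 0) ->
  vle (\sum_j l j 0 *: (P j *m u j))
      ((\sum_j l j 0 *: P j) *m cvx_comb l u).
Proof.
move=> [l_ge0 l1] Pu.
set S := \sum_j _; set Q := \sum_j _; set v := cvx_comb l u.
have avg_const q (c : 'M[R]_(p, q)) : \sum_j l j 0 *: c = c.
  by rewrite -scaler_suml l1 scale1r.
(* Expand bilinearly and average over [j] with [i] fixed: [u j] averages to [v], [P j] to [Q], and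
   the diagonal products to [S]. *)
have inner i : \sum_j l j 0 *: ((P i - P j) *m (u i - u j)) =
    P i *m u i - P i *m v - Q *m u i + S.
  transitivity (\sum_j (l j 0 *: (P i *m u i) - l j 0 *: (P i *m u j)
      - l j 0 *: (P j *m u i) + l j 0 *: (P j *m u j))).
    apply: eq_bigr => j _; rewrite mulmxBl !mulmxBr !scalerBr.
    by rewrite opprB addrA addrAC.
  rewrite big_split !sumrB /= avg_const; congr (_ - _ - _ + _).
    by rewrite mulmx_sumr; apply: eq_bigr => j _; rewrite scalemxAr.
  by rewrite mulmx_suml; apply: eq_bigr => j _; rewrite scalemxAl.
(* Averaging over [i] as well turns each cross term into [Q *m v], and the two outer terms each give
   [S]. *)
have outer : \sum_i l i 0 *: \sum_j l j 0 *: ((P i - P j) *m (u i - u j)) =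
    (S - Q *m v) *+ 2.
  under eq_bigr => i _ do rewrite inner !(scalerDr, scalerN).
  rewrite big_split !sumrB /= avg_const.
  have -> : \sum_i l i 0 *: (P i *m v) = Q *m v.
    by rewrite mulmx_suml; apply: eq_bigr => j _; rewrite scalemxAl.
  have -> : \sum_i l i 0 *: (Q *m u i) = Q *m v.
    by rewrite mulmx_sumr; apply: eq_bigr => j _; rewrite scalemxAr.
  by rewrite -/S mulr2n addrA addrAC.
move=> r; rewrite -subr_le0.
have -> : S r 0 - (Q *m v) r 0 = (S - Q *m v) r 0 by rewrite !mxE.
rewrite -(pmulrn_lle0 _ (isT : (0 < 2)%N)) -mulmxnE -outer summxE sumr_le0// => i _.
rewrite mxE mulr_ge0_le0// summxE sumr_le0// => j _.
by rewrite mxE mulr_ge0_le0//; have := Pu i j r; rewrite [X in _ <= X]mxE.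
Qed.

Theorem theorem3 (R : realType) (n m p N : nat)
  (X : set 'cV[R]_n) (U : set 'cV[R]_m)
  (f : 'cV[R]_n -> 'cV[R]_n) (g : 'cV[R]_n -> 'M[R]_(n, m))
  (f_lip : locally_lipschitz f)
  (g_lip : locally_lipschitz g)
  (U_neq0 : U !=set0) (U_compact : compact U)
  (U_convex : @convex_set R 'cV[R]_m U)
  (h : 'I_p -> 'cV[R]_n -> R) (h_C1 : forall i, C1_on X (h i))
  (alpha : 'I_p -> R -> R) (alphaK : forall i, ext_class_Kinf (alpha i))
  (xv : 'I_N -> 'cV[R]_n) (xvX : forall j, X (xv j))
  (H := cvx_hull xv) (HX : H `<=` X)
  (delta_concave : concave_map H (delta f h alpha))
  (Psi_columns : forall k : 'I_m,
     [\/ concave_map H (fun x => col k (Psi g h x)),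
         convex_map H (fun x => col k (Psi g h x))
       | affine_map H (fun x => col k (Psi g h x))])
  (uv : 'I_N -> 'cV[R]_m)
  (uvU : forall j, (U `&` sign_cone H (Psi g h)) (uv j))
  (uv_feasible : forall j,
     vle 0 (Psi g h (xv j) *m uv j + delta f h alpha (xv j)))
  (uv_monotone : forall i j,
     vle ((Psi g h (xv i) - Psi g h (xv j)) *m (uv i - uv j)) 0) :
  forall (l : 'cV[R]_N), @simplex R N l ->
  forall x : 'cV[R]_n, x = cvx_comb l xv ->
    vle 0 (Psi g h x *m cvx_comb l uv + delta f h alpha x).
Proof.
move=> l l_simp x xE i; have [l_ge0 l1] := l_simp.
set v := cvx_comb l uv.
have convH := cvx_hull_convex _ _ _ xv.
have xvH j : xv j \in H by apply: mem_set; exact: cvx_hull_vertex.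
have jensen (phi : 'cV[R]_n -> R^o) : concave_function (E := 'cV[R]_n) H phi ->
    \sum_j l j 0 * phi (xv j) <= phi x.
  by move=> cphi; rewrite xE; apply: (concave_function_sum _ _ H phi).
(* Jensen for entry [(i, k)] is multiplied by [v k 0], which has the sign prescribed by the cone
   because it is an average of the [uv j k 0]. *)
have Psi_jensen k :
    \sum_j l j 0 * (Psi g h (xv j) i k * v k 0) <= Psi g h x i k * v k 0.
  have vE : v k 0 = \sum_j l j 0 * uv j k 0.
    by rewrite summxE; apply: eq_bigr => j _; rewrite mxE.
  have colE y : col k (Psi g h y) i 0 = Psi g h y i k by rewrite mxE.
  have concP : concave_map H (fun x => col k (Psi g h x)) ->
      \sum_j l j 0 * Psi g h (xv j) i k <= Psi g h x i k.
    by move=> /(_ i)/jensen; under eq_bigr do rewrite colE; rewrite colE.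
  have convP : convex_map H (fun x => col k (Psi g h x)) ->
      Psi g h x i k <= \sum_j l j 0 * Psi g h (xv j) i k.
    move=> /(_ i)/convex_function_opp/jensen.
    under eq_bigr do rewrite colE mulrN.
    by rewrite colE sumrN lerN2.
  under eq_bigr do rewrite mulrA; rewrite -mulr_suml.
  have := fun j => (uvU j).2 k; rewrite /sign_set.
  (* An affine column satisfies Jensen in both directions, so equality holds and the sign of [v k 0]
     does not matter. *)
  case: asboolP => [affP _|naffP].
    suff -> : \sum_j l j 0 * Psi g h (xv j) i k = Psi g h x i k by [].
    by apply/le_anti; rewrite concP ?convP//= => r t y z yH zH; rewrite affP.
  case: asboolP => [/concP le_P u_ge0|nconcP u_le0].
    by rewrite ler_wpM2r// vE sumr_ge0// => j _; rewrite mulr_ge0//; exact: u_ge0.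
  (* Neither affine nor concave, the column must be convex; the factor [v k 0 <= 0] reverses its
     Jensen inequality. *)
  rewrite ler_wnM2r//; last by case: (Psi_columns k).
  by rewrite vE sumr_le0// => j _; rewrite mulr_ge0_le0//; exact: u_le0.
(* Exchanging the sums over vertices and columns reduces this to [Psi_jensen] for each [k]. *)
have Psi_le : ((\sum_j l j 0 *: Psi g h (xv j)) *m v) i 0 <=
    (Psi g h x *m v) i 0.
  rewrite [leRHS]mxE mulmx_suml summxE.
  under eq_bigr => j _ do rewrite -scalemxAl !mxE mulr_sumr.
  by rewrite exchange_big /=; apply: ler_sum => k _; exact: Psi_jensen.
have /le_trans/(_ Psi_le) :=
  vle_mul_cvx_comb _ _ _ _ _ _ uv l_simp uv_monotone i.
move=> /lerD/(_ (jensen _ (delta_concave i))).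
rewrite [in X in _ -> X]mxE [X in _ -> _ <= X]mxE; apply: le_trans.
(* Merged into one sum, the lower bound has as its terms the vertex inequalities at row [i],
   weighted by [l j 0]. *)
rewrite summxE -big_split sumr_ge0//= => j _.
rewrite mxE -mulrDr mulr_ge0//.
by have := uv_feasible j i; rewrite mxE [leRHS]mxE.
Qed.
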